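(* Let $D$ be a principal ideal domain, with quotient field $K$, such that the set $\operatorname{Max}(D)$ of maximal ideals of $D$ is finite. (1) The lattice $\operatorname{Semistar}(D)$ of all semistar operations on $D$ is isomorphic to the lattice $\mathsf{C}(2^{\operatorname{Max}(D)})$ of all closure operations on the complete lattice $2^{\operatorname{Max}(D)}$. Explicitly, the map $\mathsf{C}(2^{\operatorname{Max}(D)}) \to \operatorname{Semistar}(D)$ acting by $$* \longmapsto \bigwedge\left\{v(I): I \in \mathcal{K}(D) \text{ and } \{\mathfrak{p} \in \operatorname{Max}(D): I D_\mathfrak{p} = K\} \in (2^{\operatorname{Max}(D)})^*\right\}$$ is a poset isomorphism; alternatively, one has $* \longmapsto \star$, where $\star$ is the largest semistar operation on $D$ such that $I \in \mathcal{K}(D)$ is $\star$-closed if $\{\mathfrak{p} \in \operatorname{Max}(D): I D_\mathfrak{p} = K\}$ is $*$-closed in $2^{\operatorname{Max}(D)}$. (2) The lattice $\operatorname{Semistar}(D)$ is anti-isomorphic to the subposet $$\operatorname{Moore}(2^{\operatorname{Max}(D)}) = \left\{\mathcal{Y} \subseteq 2^{\operatorname{Max}(D)} : \mathcal{Y} \text{ is closed under arbitrary intersections}\right\}$$ of $2^{2^{\operatorname{Max}(D)}}$. Explicitly, the map $\operatorname{Semistar}(D) \to \operatorname{Moore}(2^{\operatorname{Max}(D)})$ acting by $$\star \longmapsto \left\{ \{\mathfrak{p} \in \operatorname{Max}(D): I^\star D_\mathfrak{p} = K\}: I \in \mathcal{K}(D) \right\}$$ is a poset anti-isomorphism with inverse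 acting by $$\mathcal{Y} \longmapsto \bigwedge\left\{v(I): I \in \mathcal{K}(D) \text{ and } \{\mathfrak{p} \in \operatorname{Max}(D): I D_\mathfrak{p} = K\} \in \mathcal{Y}\right\}.$$
   Context: A closure operation on a poset $S$ is a self-map $\star: x \mapsto x^\star$ of $S$ such that, for all $x,y\in S$: $x \leq x^\star$; $x \leq y$ implies $x^\star \leq y^\star$; and $(x^\star)^\star = x^\star$. An element $x$ is $\star$-closed if $x^\star = x$, and $S^\star = \{x^\star : x \in S\}$ denotes the set of $\star$-closed elements. The set $\mathsf{C}(S)$ of all closure operations on $S$ is partially ordered by $\star_1 \leq \star_2$ iff $x^{\star_1} \leq x^{\star_2}$ for all $x\in S$. For an integral domain $D$ with quotient field $K$, $\mathcal{K}(D)$ is the lattice of all nonzero $D$-submodules of $K$, ordered by inclusion, and $D_\mathfrak{p}$ is the localization of $D$ at $\mathfrak{p}$. A semistar operation on $D$ is a closure operation $\star$ on $\mathcal{K}(D)$ such that $I^\star J^\star \subseteq (IJ)^\star$ for all $I,J\in\mathcal{K}(D)$. The set $\operatorname{Semistar}(D)$ of all semistar operations on $D$ is partially ordered by $\star_1 \leq \star_2$ iff $I^{\star_1}\subseteq I^{\star_2}$ for all $I \in \mathcal{K}(D)$; it is a complete lattice, with $I^{\bigwedge\Gamma} = \bigcap\{I^\star : \star\in\Gamma\}$ for $\Gamma \subseteq \operatorname{Semistar}(D)$ (the empty intersection being $K$). For $J \in \mathcal{K}(D)$, $v(J)$ denotes the semistar operation on $D$ given by $I^{v(J)} = (J:_K(J:_K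 I))$, where $(A:_K B) = \{x \in K : xB\subseteq A\}$. For any set $X$, $2^X$ is the power set of $X$, partially ordered by inclusion. ''Closed under arbitrary intersections'' for $\mathcal{Y}\subseteq 2^X$ includes the empty intersection, so $X \in \mathcal{Y}$.
   Formalization: D is additionally assumed not to be a field: if D = K is a field, Max(D) = {0} and Semistar(D) has one element, while there are two closure operations on the power set of Max(D), so the claim fails. *)

(* Defs.v *)
From HB Require Import structures.
From mathcomp Require Import all_boot all_order all_algebra.
From mathcomp Require Import all_classical.

Set Implicit Arguments.
Unset Strict Implicit.
Unset Printing Implicit Defensive.

Import Order.TTheory GRing.Theory.

Local Open Scope classical_set_scope.
Local Open Scope ring_scope.

Definition order_iso d1 d2 (S : porderType d1) (T : porderType d2)
    (f : S -> T) : Prop :=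
  bijective f /\ {mono f : x y / (x <= y)%O}.

Definition order_anti_iso d1 d2 (S : porderType d1) (T : porderType d2)
    (f : S -> T) : Prop :=
  bijective f /\ {mono f : x y /~ (x <= y)%O}.

Definition is_greatest d (S : porderType d) (A : set S) (x : S) : Prop :=
  A x /\ ubound A x.

Definition is_closure d (S : porderType d) (f : S -> S) : Prop :=
  [/\ forall x, (x <= f x)%O,
      {homo f : x y / (x <= y)%O}
    & forall x, f (f x) = f x].

Record closure_op d (S : porderType d) := ClosureOp {
  closure_fun :> S -> S;
  closure_opP : `[< is_closure closure_fun >]
}.

(* The order is inherited from the pointwise order on [S -> S] of [boolp]. *)
HB.instance Definition _ d (S : porderType d) := [isSub for @closure_fun d S].
HB.instance Definition _ d (S : porderType d) :=
  [Choice of closure_op S by <:].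
HB.instance Definition _ d (S : porderType d) :=
  [SubChoice_isSubPOrder of closure_op S by <: with FunOrder.fun_display].

Definition is_closed d (S : porderType d) (c : closure_op S) (x : S) : Prop :=
  c x = x.

Definition closed_elements d (S : porderType d) (c : closure_op S) : set S :=
  range c.

Lemma closure_opE d (S : porderType d) (c : closure_op S) : is_closure c.
Proof. exact/asboolP/(closure_opP c). Qed.

Lemma closure_op_leP d (S : porderType d) (c1 c2 : closure_op S) :
  (c1 <= c2)%O <-> forall x, (c1 x <= c2 x)%O.
Proof. by split => [/asboolP//|h]; apply/asboolP. Qed.

(* The case [F = set0] forces [setT] to belong to [Y]. *)
Definition is_moore T (Y : set (set T)) : Prop :=
  forall F : set (set T), F `<=` Y -> Y (\bigcap_(A in F) A).

Record moore T := Moore {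
  moore_set :> set (set T);
  mooreP : `[< is_moore moore_set >]
}.

HB.instance Definition _ T := [isSub for @moore_set T].
HB.instance Definition _ T := [Choice of moore T by <:].
HB.instance Definition _ T :=
  [SubChoice_isSubPOrder of moore T by <: with set_display].

Lemma moore_leP T (Y1 Y2 : moore T) : (Y1 <= Y2)%O <-> Y1 `<=` Y2.
Proof. by split => /asboolP. Qed.

Definition is_ideal (D : idomainType) (I : set D) : Prop :=
  [/\ I 0, forall x y, I x -> I y -> I (x + y)
    & forall a x, I x -> I (a * x)].

Definition principal_ideal_domain (D : idomainType) : Prop :=
  forall I : set D, is_ideal I -> exists a, I = range (fun x => x * a).

Definition is_maximal_ideal (D : idomainType) (m : set D) : Prop :=
  [/\ is_ideal m, m <> setT
    & forall J, is_ideal J -> m `<=` J -> J = m \/ J = setT].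

Definition Max (D : idomainType) : Type := {m : set D | is_maximal_ideal m}.

Definition is_submodule (D : idomainType) (I : set {fraction D}) : Prop :=
  [/\ I 0, forall x y, I x -> I y -> I (x + y)
    & forall a x, I x -> I (tofrac a * x)].

Definition is_nz_submodule (D : idomainType) (I : set {fraction D}) : Prop :=
  is_submodule I /\ exists2 x, I x & x != 0.

Record submod (D : idomainType) := Submod {
  submod_set :> set {fraction D};
  submodP : `[< is_nz_submodule submod_set >]
}.

HB.instance Definition _ D := [isSub for @submod_set D].
HB.instance Definition _ D := [Choice of submod D by <:].
HB.instance Definition _ D :=
  [SubChoice_isSubPOrder of submod D by <: with set_display].

Definition mk_submod (D : idomainType) (I : set {fraction D})
  (hI : is_nz_submodule I) : submod D := Submod (asboolT hI).

Lemma submodE (D : idomainType) (I : submod D) : is_nz_submodule I.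
Proof. exact/asboolP/(submodP I). Qed.

Lemma submod_leP (D : idomainType) (I J : submod D) :
  (I <= J)%O <-> I `<=` J.
Proof. by split => /asboolP. Qed.

Lemma submod_inj (D : idomainType) (I J : submod D) :
  I = J :> set {fraction D} -> I = J.
Proof. exact: val_inj. Qed.

Definition setprod (D : idomainType) (A B : set {fraction D}) :
    set {fraction D} :=
  [set z | exists2 s : seq ({fraction D} * {fraction D}),
    (forall u, u \in s -> A u.1 /\ B u.2) & z = \sum_(u <- s) u.1 * u.2].

Definition colon (D : idomainType) (A B : set {fraction D}) :
    set {fraction D} :=
  [set x | forall y, B y -> A (x * y)].

(* [p] contains 0, so the denominators [s] are nonzero. *)
Definition localization (D : idomainType) (p : Max D) : set {fraction D} :=
  [set x | exists a s : D, ~ sval p s /\ x = tofrac a / tofrac s].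

Definition full_primes (D : idomainType) (I : submod D) : set (Max D) :=
  [set p | setprod I (localization p) = setT].

Lemma setprod_in (D : idomainType) (A B : set {fraction D}) x y :
  A x -> B y -> setprod A B (x * y).
Proof.
move=> Ax By; exists [:: (x, y)]; last by rewrite big_seq1.
by move=> u; rewrite inE => /eqP ->.
Qed.

Lemma setprod_sub (D : idomainType) (A B C : set {fraction D}) :
  is_submodule C -> (forall x y, A x -> B y -> C (x * y)) ->
  setprod A B `<=` C.
Proof.
move=> [C0 CD _] h z [s hs ->]; rewrite big_seq.
by elim/big_ind: _ => // u /hs[]; exact: h.
Qed.

Lemma setprod_nz_submodule (D : idomainType) (I J : submod D) :
  is_nz_submodule (setprod I J).
Proof.
have [[_ _ IM] [x Ix x0]] := submodE I.
have [_ [y Jy y0]] := submodE J.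
split; last by exists (x * y); [exact: setprod_in|rewrite mulf_neq0].
split.
- by exists [::]; rewrite ?big_nil.
- move=> _ _ [s hs ->] [t ht ->]; exists (s ++ t); last by rewrite big_cat.
  by move=> u; rewrite mem_cat => /orP[/hs|/ht].
- move=> a _ [s hs ->]; exists [seq (tofrac a * u.1, u.2) | u <- s].
    by move=> _ /mapP[u /hs[Iu Ju] ->] /=; split => //; exact: IM.
  rewrite big_map mulr_sumr; apply: eq_bigr => u _ /=.
  by rewrite mulrA.
Qed.

Definition submod_mul (D : idomainType) (I J : submod D) : submod D :=
  mk_submod (setprod_nz_submodule I J).

Definition is_semistar (D : idomainType) (c : closure_op (submod D)) : Prop :=
  forall I J : submod D,
    (submod_mul (c I) (c J) <= c (submod_mul I J))%O.

Record semistar (D : idomainType) := Semistar {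
  semistar_closure :> closure_op (submod D);
  semistarP : `[< is_semistar semistar_closure >]
}.

HB.instance Definition _ D := [isSub for @semistar_closure D].
HB.instance Definition _ D := [Choice of semistar D by <:].
HB.instance Definition _ D :=
  [SubChoice_isSubPOrder of semistar D by <: with FunOrder.fun_display].

Definition mk_semistar (D : idomainType) (f : submod D -> submod D)
  (hf : is_closure f) (hs : is_semistar (ClosureOp (asboolT hf))) :
  semistar D := Semistar (asboolT hs).

Lemma semistarE (D : idomainType) (s : semistar D) : is_semistar s.
Proof. exact/asboolP/(semistarP s). Qed.

Lemma semistar_leP (D : idomainType) (s t : semistar D) :
  (s <= t)%O <-> forall I, s I `<=` t I.
Proof.
split=> [/closure_op_leP h I|h]; first exact/submod_leP.
by apply/closure_op_leP => I; apply/submod_leP/h.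
Qed.

Lemma inf_nz_submodule (D : idomainType) (G : set (semistar D))
  (I : submod D) : is_nz_submodule (\bigcap_(s in G) (s I : set _)).
Proof.
split; last first.
  have [_ [x Ix x0]] := submodE I; exists x => // s _.
  by have [+ _ _] := closure_opE s => /(_ I)/submod_leP; exact.
split.
- by move=> s _; have [[]] := submodE (s I).
- move=> x y hx hy s Gs; have [[_ h _] _] := submodE (s I).
  by apply: h; [exact: hx|exact: hy].
- move=> a x hx s Gs; have [[_ _ h] _] := submodE (s I).
  by apply: h; exact: hx.
Qed.

Definition inf_fun (D : idomainType) (G : set (semistar D)) (I : submod D) :
  submod D := mk_submod (inf_nz_submodule G I).

Lemma inf_closure (D : idomainType) (G : set (semistar D)) :
  is_closure (inf_fun G).
Proof.
have ext I : (I <= inf_fun G I)%O.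
  apply/submod_leP => x Ix s _.
  by have [+ _ _] := closure_opE s => /(_ I)/submod_leP; exact.
split=> // [I J IJ|I].
  apply/submod_leP => x hx s Gs; have [_ + _] := closure_opE s.
  by move=> /(_ _ _ IJ)/submod_leP; apply; exact: hx.
apply/le_anti; rewrite ext andbT; apply/submod_leP => x hx s Gs.
have [_ mono idem] := closure_opE s; rewrite -idem.
have /mono/submod_leP : (inf_fun G I <= s I)%O.
  by apply/submod_leP => y; exact.
by apply; exact: hx.
Qed.

Lemma inf_semistar (D : idomainType) (G : set (semistar D)) :
  is_semistar (ClosureOp (asboolT (inf_closure G))).
Proof.
move=> I J; apply/submod_leP; apply: setprod_sub; first exact: (submodE _).1.
move=> x y hx hy s Gs; have /submod_leP := @semistarE _ s I J; apply.
by apply: setprod_in; [exact: hx|exact: hy].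
Qed.

Definition semistar_inf (D : idomainType) (G : set (semistar D)) :
  semistar D := mk_semistar (inf_semistar G).

Lemma semistar_infE (D : idomainType) (G : set (semistar D)) I :
  semistar_inf G I = \bigcap_(s in G) (s I : set _) :> set {fraction D}.
Proof. by []. Qed.

Lemma semistar_inf_glb (D : idomainType) (G : set (semistar D)) :
  is_greatest (lbound G) (semistar_inf G).
Proof.
split=> [s Gs|t tG]; apply/semistar_leP => I x hx; first exact: hx.
by move=> s /tG/semistar_leP; exact.
Qed.

Lemma v_nz_submodule (D : idomainType) (J I : submod D) :
  is_nz_submodule (colon J (colon J I)).
Proof.
have [[J0 JD JM] _] := submodE J; have [_ [x Ix x0]] := submodE I.
split; last by exists x => // y; rewrite mulrC; exact.
split.
- by move=> y _; rewrite mul0r.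
- by move=> y z hy hz u hu; rewrite mulrDl; apply: JD; [exact: hy|exact: hz].
- by move=> a y hy u hu; rewrite -mulrA; apply: JM; exact: hy.
Qed.

Definition v_fun (D : idomainType) (J I : submod D) : submod D :=
  mk_submod (v_nz_submodule J I).

Lemma v_closure (D : idomainType) (J : submod D) : is_closure (v_fun J).
Proof.
split=> [I|I1 I2 /submod_leP I12|I].
- by apply/submod_leP => x Ix y; rewrite mulrC; exact.
- apply/submod_leP => x hx y hy; apply: hx => z /I12; exact: hy.
- apply: submod_inj; apply/seteqP; split => x hx y hy; apply: hx => z.
    by move=> /(_ _ hy); rewrite mulrC.
  by move=> Iz; apply: hy => w; rewrite mulrC; exact.
Qed.

Lemma v_semistar (D : idomainType) (J : submod D) :
  is_semistar (ClosureOp (asboolT (v_closure J))).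
Proof.
move=> A B; apply/submod_leP; apply: setprod_sub; first exact: (submodE _).1.
move=> x y hx hy z hz; rewrite -mulrA; apply: hx => a Aa.
rewrite -mulrA; apply: hy => b Bb.
have -> : z * a * b = z * (a * b) by rewrite mulrA.
by apply: hz; exact: setprod_in.
Qed.

Definition v_op (D : idomainType) (J : submod D) : semistar D :=
  mk_semistar (v_semistar J).

Lemma v_opE (D : idomainType) (J I : submod D) :
  v_op J I = colon J (colon J I) :> set {fraction D}.
Proof. by []. Qed.

(* Main.v *)
Require Import Defs.
From mathcomp Require Import all_boot all_order all_algebra.
From mathcomp Require Import all_classical.
From mathcomp Require Import generic_quotient ring.

(* Write D_A for the intersection of the localizations D_p with p not in A, and
   full I for the set of the p with I D_p = K.  If p = (a), then p is in full I
   if and only if I is stable under division by a; hence full D_A = A.  As Max D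
   is finite, there is a nonzero x in I such that x / a is not in I for any
   p = (a) outside full I, and then I = x D_(full I).  Semistar operations
   commute with multiplication by a nonzero scalar, so whether I is closed
   depends only on full I, and a semistar operation amounts to the family of
   the A such that D_A is closed. *)

Set Implicit Arguments.
Unset Strict Implicit.
Unset Printing Implicit Defensive.

Import Order.TTheory GRing.Theory.

Local Open Scope classical_set_scope.
Local Open Scope ring_scope.

(** * Fractions and maximal ideals *)

Lemma tofrac_fracP (D : idomainType) (x : {fraction D}) :
  exists a b : D, b != 0 /\ x = tofrac a / tofrac b.
Proof.
elim/quotW: x => x; exists (frac x).1, (frac x).2.
have b0 := denom_ratioP x; split => //.
apply: (mulIf (x := tofrac (frac x).2)); first by rewrite tofrac_eq0.
rewrite divfK ?tofrac_eq0//; apply/eqP.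
rewrite -[_ * _]/(FracField.mul _ _) !piE /FracField.mulf.
by rewrite FracField.equivfE !numden_Ratio ?mulf_neq0 ?oner_eq0// !mulr1 mulrC.
Qed.

Lemma ideal_eqT (D : idomainType) (I : set D) : is_ideal I -> I 1 -> I = setT.
Proof.
move=> [_ _ IM] I1; apply/seteqP; split => // x _.
by rewrite -[x]mulr1; exact: IM.
Qed.

Lemma ideal_le_maximal (D : idomainType) (I : set D) :
  is_ideal I -> ~ I 1 -> exists m : Max D, I `<=` sval m.
Proof.
(* Joining [I] to [X] makes the empty chain harmless in Zorn's lemma. *)
move=> Iid I1; pose P X := is_ideal (I `|` X) /\ ~ (I `|` X) 1.
have [F FP Ftot|A [[Aid A1] Amax]] := @Zorn_bigcup D P.
  split; last by move=> [//|[X /FP[_ +] X1]]; apply; right.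
  have [I0 ID IM] := Iid; split; first by left.
    have mixed x y X : I x -> F X -> X y -> (I `|` \bigcup_(X in F) X) (x + y).
      move=> Ix FX Xy; have [[_ XD _] _] := FP _ FX.
      have [] := XD x y (or_introl Ix) (or_intror Xy); first by left.
      by right; exists X.
    move=> x y [Ix|[X FX Xx]] [Iy|[Y FY Yy]].
    - by left; exact: ID.
    - exact: (mixed x y Y).
    - by rewrite addrC; exact: (mixed y x X).
    - wlog XY : x y X Y FX FY Xx Yy / X `<=` Y => [wh|].
        have [XY|YX] := Ftot _ _ FX FY; first exact: (wh x y X Y).
        by rewrite addrC; exact: (wh y x Y X).
      have [[_ YD _] _] := FP _ FY.
      have [] := YD x y (or_intror (XY _ Xx)) (or_intror Yy); first by left.
      by right; exists Y.
  move=> a x [Ix|[X FX Xx]]; first by left; exact: IM.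
  have [[_ _ XM] _] := FP _ FX.
  by have [] := XM a x (or_intror Xx); [left|right; exists X].
have mM : is_maximal_ideal (I `|` A).
  split=> // [AT|J Jid AJ]; first by apply: A1; rewrite AT.
  have [/(ideal_eqT Jid)|J1] := pselect (J 1); first by right.
  left; apply/seteqP; split => //; apply: contrapT => JA.
  have IJ : I `|` J = J by apply/setUidr => x Ix; apply: AJ; left.
  apply: (Amax J); last by split; rewrite IJ.
  split; first by move=> x Ax; apply: AJ; right.
  by move=> JsA; apply: JA => x /JsA; right.
by exists (exist _ _ mM) => x; left.
Qed.

Lemma maximal_ideal (D : idomainType) (p : Max D) : is_ideal (sval p).
Proof. by case: p => m []. Qed.

Lemma maximal_neq1 (D : idomainType) (p : Max D) : ~ sval p 1.
Proof.
by case: p => m [/= mid mT _] m1; apply: mT; exact: ideal_eqT.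
Qed.

Lemma maximal_eq (D : idomainType) (p q : Max D) :
  sval p `<=` sval q -> p = q.
Proof.
move=> pq; have q1 := @maximal_neq1 _ q; have qid := maximal_ideal q.
case: p q pq q1 qid => [p pP] [q qP] /= pq q1 qid; apply: eq_exist.
by have [_ _ /(_ _ qid pq)[->//|qT]] := pP; case: q1; rewrite qT.
Qed.

(** The ideal generated by [s] and [p] is strictly larger than [p], hence contains 1. *)
Lemma maximal_bezout (D : idomainType) (p : Max D) (s : D) :
  ~ sval p s -> exists a b, sval p b /\ a * s + b = 1.
Proof.
move=> ps; have [p0 pD pM] := maximal_ideal p.
pose J := [set x | exists a b, sval p b /\ x = a * s + b].
have Jid : is_ideal J.
  split; first by exists 0, 0; rewrite mul0r addr0.
    move=> _ _ [a [b [pb ->]]] [a' [b' [pb' ->]]]; exists (a + a'), (b + b').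
    by split; [exact: pD|rewrite mulrDl addrACA].
  move=> c _ [a [b [pb ->]]]; exists (c * a), (c * b).
  by split; [exact: pM|rewrite mulrDr mulrA].
have [_ _ /(_ _ Jid)] : is_maximal_ideal (sval p) by case: (p).
case.
- by move=> x px; exists 0, x; rewrite mul0r add0r.
- move=> Jp; case: ps; rewrite -Jp; exists 1, 0.
  by rewrite mul1r addr0.
- move=> JT; have [a [b [pb ab]]] : J 1 by rewrite JT.
  by exists a, b.
Qed.

(** Maximal ideals are prime: multiply a * x + b = 1 by [y]. *)
Lemma maximal_mul (D : idomainType) (p : Max D) (x y : D) :
  ~ sval p x -> ~ sval p y -> ~ sval p (x * y).
Proof.
move=> /maximal_bezout[a [b [pb ab]]] py pxy; apply: py.
have [_ pD pM] := maximal_ideal p.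
rewrite -[y]mul1r -ab mulrDl; apply: pD; first by rewrite -mulrA; exact: pM.
by rewrite mulrC; exact: pM.
Qed.

Lemma maximal_neq0 (D : idomainType) (p : Max D) (s : D) :
  ~ sval p s -> s != 0.
Proof.
by move=> ps; apply/eqP => s0; apply: ps; rewrite s0; case: (maximal_ideal p).
Qed.

(** * Full primes and division by a generator *)

(** A finite sum of products has a common denominator outside [p], since the complement of [p] is
    multiplicative. *)
Lemma setprod_localizationP (D : idomainType) (I : submod D) (p : Max D) z :
  setprod I (localization p) z <->
  exists2 s, ~ sval p s & submod_set I (tofrac s * z).
Proof.
have [[I0 ID IM] _] := submodE I; split; last first.
  move=> [s ps Isz].
  have s0 : tofrac s != 0 by rewrite tofrac_eq0 (maximal_neq0 ps).
  rewrite [z](_ : _ = (tofrac s * z) * (tofrac 1 / tofrac s)); last first.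
    by rewrite tofrac1 mul1r mulrC mulKf.
  by apply: setprod_in => //; exists 1, s.
move: z; apply: (@setprod_sub _ _ _
    [set z | exists2 s, ~ sval p s & submod_set I (tofrac s * z)]).
  split=> [|x y [s ps Isx] [t pt Ity]|a x [s ps Isx]] /=.
  - by exists 1; [exact: maximal_neq1|rewrite mulr0].
  - exists (s * t); first exact: maximal_mul.
    rewrite [X in submod_set I X](_ : _ =
        tofrac t * (tofrac s * x) + tofrac s * (tofrac t * y)).
      by apply: ID; exact: IM.
    by rewrite tofracM mulrDr -!mulrA [X in X + _]mulrCA.
  - by exists s => //; rewrite mulrCA; exact: IM.
move=> x _ Ix [a [s [ps ->]]]; exists s => //.
have s0 : tofrac s != 0 by rewrite tofrac_eq0 (maximal_neq0 ps).
rewrite [X in submod_set I X](_ : _ = tofrac a * x); first exact: IM.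
by rewrite mulrCA [tofrac s * _]mulrC divfK// mulrC.
Qed.

Lemma full_primesP (D : idomainType) (I : submod D) (p : Max D) :
  full_primes I p <->
  forall z, exists2 s, ~ sval p s & submod_set I (tofrac s * z).
Proof.
split=> [fp z|h]; first by apply/setprod_localizationP; rewrite fp.
by apply/seteqP; split => // z _; apply/setprod_localizationP; exact: h.
Qed.

Definition uniformizer (D : idomainType) (p : Max D) (a : D) :=
  a != 0 /\ sval p = range (fun x => x * a).

(** A zero generator would make the zero ideal maximal and [D] a field. *)
Lemma ex_uniformizer (D : idomainType) (p : Max D) :
  principal_ideal_domain D -> ~ GRing.field_axiom D ->
  exists a, uniformizer p a.
Proof.
move=> pid nfield; have [a pa] := pid _ (maximal_ideal p).
exists a; split => //; apply/eqP => a0; apply: nfield => x x0.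
have px : ~ sval p x.
  by rewrite pa a0 => -[y _] /eqP; rewrite mulr0 eq_sym (negbTE x0).
have [b [c []]] := maximal_bezout px.
rewrite pa a0 => -[y _ <-]; rewrite mulr0 addr0 => bx.
by apply/unitrPr; exists b; rewrite mulrC.
Qed.

(* [u] generates the ideal of the [z] such that [b] divides [a ^+ n * z] for
   some [n]. *)
Lemma uniformizer_split (D : idomainType) (p : Max D) (a b : D) :
  principal_ideal_domain D -> uniformizer p a -> b != 0 ->
  exists u t w n, [/\ ~ sval p u, b = u * t & a ^+ n = t * w].
Proof.
move=> pid [a0 pa] b0; pose S := [set z | exists n w, a ^+ n * z = b * w].
have Sid : is_ideal S.
  split; first by exists 0%N, 0; rewrite !mulr0.
    move=> x y [n [w nx]] [m [v my]].
    exists (n + m)%N, (a ^+ m * w + a ^+ n * v).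
    rewrite (_ : _ * _ = a ^+ m * (a ^+ n * x) + a ^+ n * (a ^+ m * y)).
      by rewrite nx my; ring.
    by rewrite exprD; ring.
  by move=> c x [n [w nx]]; exists n, (c * w); rewrite mulrCA nx mulrCA.
have [u Su] := pid _ Sid.
have [n [w nw]] : S u by rewrite Su; exists 1; rewrite ?mul1r.
have [t _ bE] : range (fun x => x * u) b.
  by rewrite -Su; exists 0%N, 1; rewrite expr0 mul1r mulr1.
have u0 : u != 0 by apply: contra_neq b0 => u0; rewrite -bE u0 mulr0.
exists u, t, w, n; split.
(* If u = u' * a, then [u'] also lies in [S], with exponent n + 1, so [u] divides it and [a] becomes
   invertible. *)
- rewrite pa => -[u' _ u'a].
  have : S u' by exists n.+1, w; rewrite exprSr -mulrA [a * _]mulrC u'a.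
  rewrite Su => -[r _ ru]; apply: (@maximal_neq1 _ p).
  rewrite pa; exists r => //.
  by apply: (mulIf u0); rewrite mulrAC ru u'a mul1r.
- by rewrite -bE mulrC.
- by apply: (mulIf u0); rewrite nw -bE mulrAC.
Qed.

(** For c / (u * t) = z / x and t * w = a ^+ n, this writes u * z as a multiple of x / a ^+ n. *)
Lemma mulf_cancel (F : fieldType) (u c t w x : F) :
  u != 0 -> t != 0 -> w != 0 ->
  u * (c / (u * t) * x) = c * w * (x / (t * w)).
Proof. by move=> u0 t0 w0; field; rewrite u0 t0 w0. Qed.

(** If s * (y / a) is in [I] with [s] outside [p], then c * s + d * a = 1 puts y / a in [I].
    Conversely, the denominator of z / x splits into some [u] outside [p] and a divisor of a power
    of [a], so [u] brings [z] into [I]. *)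
Lemma full_primes_div (D : idomainType) (I : submod D) (p : Max D) (a : D) :
  principal_ideal_domain D -> uniformizer p a ->
  full_primes I p <-> forall x, submod_set I x -> submod_set I (x / tofrac a).
Proof.
move=> pid ua; have [[I0 ID IM] [x Ix x0]] := submodE I.
have [a0 pa] := ua; have Fa0 : tofrac a != 0 by rewrite tofrac_eq0.
split=> [/full_primesP fp y Iy|Idiv].
  have [s ps Is] := fp (y / tofrac a).
  have [c [b []]] := maximal_bezout ps; rewrite pa => -[d _ <-] cd.
  rewrite -[y / _]mul1r -tofrac1 -cd tofracD !tofracM mulrDl.
  apply: ID; first by rewrite -mulrA; exact: IM.
  by rewrite -mulrA [_ * (y / _)]mulrC divfK//; exact: IM.
apply/full_primesP => z; have [c [b [b0 zxE]]] := tofrac_fracP (z / x).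
have [u [t [w [n [pu bE anE]]]]] := uniformizer_split pid ua b0.
exists u => //.
have Ian k : submod_set I (x / tofrac a ^+ k).
  elim: k => [|k IH]; first by rewrite expr0 divr1.
  by rewrite exprSr invfM mulrA; exact: Idiv.
have an0 : tofrac (a ^+ n) != 0 by rewrite tofrac_eq0 expf_neq0.
have t0 : tofrac t != 0.
  by move: an0; rewrite anE tofracM mulf_eq0 => /norP[].
have w0 : tofrac w != 0.
  by move: an0; rewrite anE tofracM mulf_eq0 => /norP[].
have u0 : tofrac u != 0 by rewrite tofrac_eq0 (maximal_neq0 pu).
rewrite -(divfK x0 z) zxE bE.
rewrite tofracM (mulf_cancel _ _ u0 t0 w0) -!tofracM -anE tofracXn.
exact: IM.
Qed.

(** * Intersections of localizations *)

Lemma localization_submodule (D : idomainType) (p : Max D) :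
  is_submodule (localization p).
Proof.
split.
- by exists 0, 1; split; [exact: maximal_neq1|rewrite tofrac0 mul0r].
- move=> _ _ [a [s [ps ->]]] [b [t [pt ->]]]; exists (a * t + b * s), (s * t).
  split; first exact: maximal_mul.
  have s0 : tofrac s != 0 by rewrite tofrac_eq0 (maximal_neq0 ps).
  have t0 : tofrac t != 0 by rewrite tofrac_eq0 (maximal_neq0 pt).
  by rewrite tofracD !tofracM addf_div.
- move=> c _ [a [s [ps ->]]]; exists (c * a), s; split => //.
  by rewrite tofracM mulrA.
Qed.

Lemma local_ring_nz_submodule (D : idomainType) (A : set (Max D)) :
  is_nz_submodule (\bigcap_(p in ~` A) localization p).
Proof.
split; last first.
  exists 1; last exact: oner_neq0.
  move=> p _; exists 1, 1; split; first exact: maximal_neq1.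
  by rewrite tofrac1 divr1.
split=> [p _|x y hx hy p Ap|a x hx p Ap];
  have [h0 hD hM] := localization_submodule p => //.
  by apply: hD; [exact: hx|exact: hy].
by apply: hM; exact: hx.
Qed.

(** This is D_A; for [A] = [setT] the intersection is empty and gives K. *)
Definition local_ring (D : idomainType) (A : set (Max D)) : submod D :=
  mk_submod (local_ring_nz_submodule A).

(** For p = (a) outside [A], 1 / a is not in D_p. For p in [A] and q outside [A], [a] is not in q,
    as p would otherwise equal q; so division by [a] preserves D_q. *)
Lemma full_primes_local_ring (D : idomainType) (A : set (Max D)) :
  principal_ideal_domain D -> ~ GRing.field_axiom D ->
  full_primes (local_ring A) = A.
Proof.
move=> pid nfield; apply/seteqP; split => p.
  move=> fp; apply: contrapT => Ap.
  have [a ua] := ex_uniformizer p pid nfield; have [a0 pa] := ua.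
  have one_in : submod_set (local_ring A) 1.
    move=> q _; exists 1, 1; split; first exact: maximal_neq1.
    by rewrite tofrac1 divr1.
  have [b [s [ps]]] := (full_primes_div _ pid ua).1 fp 1 one_in p Ap.
  move=> /eqP; rewrite eqr_div ?tofrac_eq0 ?(maximal_neq0 ps)// mul1r.
  rewrite -tofracM tofrac_eq => /eqP sE.
  by apply: ps; rewrite pa; exists b.
move=> Ap.
have [a ua] := ex_uniformizer p pid nfield; have [a0 pa] := ua.
apply/(full_primes_div _ pid ua) => x hx q Aq.
have [b [s [qs ->]]] := hx q Aq; exists b, (a * s).
have s0 : tofrac s != 0 by rewrite tofrac_eq0 (maximal_neq0 qs).
split; last by rewrite tofracM invfM mulrA mulrAC.
apply: maximal_mul => // qa; apply: Aq.
rewrite -(@maximal_eq _ p q)// pa => _ [y _ <-].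
by have [_ _] := maximal_ideal q; exact.
Qed.

(** * Structure of submodules when [Max D] is finite *)

Lemma finite_Max_seq (D : idomainType) :
  finite_set [set: Max D] -> exists l : seq {classic Max D}, forall p, p \in l.
Proof.
move=> /(@finite_seqP {classic Max D})[l lE]; exists l => p.
by have : [set: {classic Max D}] p by []; rewrite lE.
Qed.

(** Take the product, over the q other than [p], of elements of q outside [p]. It serves to modify
    an element at [p] alone. *)
Lemma maximal_separator (D : idomainType) (p : Max D) :
  finite_set [set: Max D] ->
  exists2 e, ~ sval p e & forall q, q <> p -> sval q e.
Proof.
move=> /finite_Max_seq[l lP].
suff [e pe le] : exists2 e, ~ sval p e &
    forall q : {classic Max D}, q \in l -> q <> p -> sval q e.
  by exists e => // q; exact: le.
elim: {lP}l => [|q l [e pe le]]; first by exists 1; [exact: maximal_neq1|].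
have [->|qp] := pselect (q = p).
  by exists e => // r; rewrite inE => /orP[/eqP->|/le].
have [y qy py] : exists2 y, sval q y & ~ sval p y.
  apply: contrapT => h; apply: qp; apply: maximal_eq => y qy.
  by apply: contrapT => py; apply: h; exists y.
exists (e * y); first exact: maximal_mul.
move=> r; rewrite inE => /orP[/eqP->|lr] rp.
  by have [_ _] := maximal_ideal q; exact.
by rewrite mulrC; have [_ _] := maximal_ideal r; apply; exact: le.
Qed.

(** Divide both terms of a fraction by a generator of the ideal they span. *)
Lemma coprime_fracP (D : idomainType) (x : {fraction D}) :
  principal_ideal_domain D ->
  exists a b u v, [/\ b != 0, x = tofrac a / tofrac b & u * a + v * b = 1].
Proof.
move=> pid; have [a [b [b0 ->]]] := tofrac_fracP x.
pose G := [set z | exists u v, z = u * a + v * b].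
have Gid : is_ideal G.
  split; first by exists 0, 0; rewrite !mul0r addr0.
    move=> _ _ [u [v ->]] [u' [v' ->]]; exists (u + u'), (v + v').
    by rewrite !mulrDl addrACA.
  move=> c _ [u [v ->]]; exists (c * u), (c * v).
  by rewrite mulrDr !mulrA.
have [g Gg] := pid _ Gid.
have [a' _ aE] : range (fun x => x * g) a.
  by rewrite -Gg; exists 1, 0; rewrite mul1r mul0r addr0.
have [b' _ bE] : range (fun x => x * g) b.
  by rewrite -Gg; exists 0, 1; rewrite mul1r mul0r add0r.
have [u [v gE]] : G g by rewrite Gg; exists 1; rewrite ?mul1r.
move: b0; rewrite -bE mulf_eq0 => /norP[b'0 g0].
exists a', b', u, v; split=> //.
  by rewrite -aE !tofracM -mulf_div divff ?mulr1// tofrac_eq0.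
by apply: (mulIf g0); rewrite mulrDl -!mulrA aE bE -gE mul1r.
Qed.

Lemma full_primes_scale_le (D : idomainType) (I J : submod D) y : y != 0 ->
  (forall x, submod_set I x -> submod_set J (y * x)) ->
  full_primes I `<=` full_primes J.
Proof.
move=> y0 IJ p /full_primesP fp; apply/full_primesP => z.
have [s ps /IJ Js] := fp (z / y); exists s => //.
by rewrite mulrCA [y * _]mulrC divfK in Js.
Qed.

(* [x] has least valuation at every maximal ideal where [I] is bounded below. *)
Lemma ex_minimal_element (D : idomainType) (I : submod D) :
  principal_ideal_domain D -> ~ GRing.field_axiom D ->
  finite_set [set: Max D] ->
  exists x, [/\ x != 0, submod_set I x & forall p a, uniformizer p a ->
    ~ full_primes I p -> ~ submod_set I (x / tofrac a)].
Proof.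
move=> pid nfield fin; have [[I0 ID IM] [y Iy y0]] := submodE I.
have IB u v : submod_set I (u + v) -> submod_set I u -> submod_set I v.
  move=> Iuv Iu; rewrite (_ : v = (u + v) + tofrac (- 1) * u).
    by apply: ID => //; exact: IM.
  by rewrite tofracN tofrac1 mulN1r addrC addKr.
have [x [Ix xP]] : exists x, submod_set I x /\ forall p a, uniformizer p a ->
    ~ full_primes I p -> ~ submod_set I (x / tofrac a).
  have [l lP] := finite_Max_seq fin.
  suff [x [Ix xP]] : exists x, submod_set I x /\
      forall p : {classic Max D}, p \in l -> forall a, uniformizer p a ->
      ~ full_primes I p -> ~ submod_set I (x / tofrac a).
    by exists x; split => // p; exact: xP.
  elim: {lP}l => [|p l [x [Ix xP]]]; first by exists y.
  have [fp|nfp] := pselect (full_primes I p).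
    by exists x; split=> // q; rewrite inE => /orP[/eqP->//|/xP].
  have [a ua] := ex_uniformizer p pid nfield; have [a0 pa] := ua.
  have Fa0 : tofrac a != 0 by rewrite tofrac_eq0.
  (* Since [b] is a multiple of [a], testing with [a] alone covers every generator of [p]. *)
  have anyP w b : uniformizer p b -> submod_set I (w / tofrac b) ->
      submod_set I (w / tofrac a).
    move=> [b0 pb] Iwb; have [c _ ca] : range (fun x => x * a) b.
      by rewrite -pa pb; exists 1; rewrite ?mul1r.
    move: b0 Iwb; rewrite -ca tofracM => b0 /(IM c); rewrite mulrCA.
    rewrite invfM mulVKf//.
    apply: contraNneq b0 => /eqP; rewrite tofrac_eq0 => /eqP->.
    by rewrite mul0r.
  have [Ixa|nIxa] := pselect (submod_set I (x / tofrac a)); last first.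
    exists x; split=> // q; rewrite inE => /orP[/eqP->|/xP//] b ub _.
    by move=> /(anyP _ _ ub).
  have [z Iz nIza] : exists2 z, submod_set I z & ~ submod_set I (z / tofrac a).
    apply: contrapT => h; apply: nfp; apply/(full_primes_div _ pid ua) => z Iz.
    by apply: contrapT => nIza; apply: h; exists z.
  (* Here x / a lies in [I], so [x] fails at [p]. Adding e * z repairs this, and at any other q =
     (b) nothing changes because e * z / b lies in [I]. *)
  have [e pe eP] := maximal_separator p fin.
  exists (x + tofrac e * z); split; first by apply: ID => //; exact: IM.
  have nIp : ~ submod_set I ((x + tofrac e * z) / tofrac a).
    rewrite mulrDl => /IB/(_ Ixa) Ieza; apply: nIza.
    have [c [d []]] := maximal_bezout pe; rewrite pa => -[r _ <-] cd.
    rewrite -[z / _]mul1r -tofrac1 -cd tofracD !tofracM mulrDl; apply: ID.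
      by rewrite -mulrA [tofrac e * _]mulrA; exact: IM.
    by rewrite -mulrA [_ * (z / _)]mulrC divfK//; exact: IM.
  move=> q; rewrite inE => /orP[/eqP->|lq] b ub nfq.
    by move=> /(anyP _ _ ub).
  have [qp|qp] := pselect (q = p).
    by move: ub; rewrite qp => ub /(anyP _ _ ub).
  rewrite mulrDl addrC => /IB Ixb; apply: (xP q lq b ub nfq); apply: Ixb.
  have [b0 qb] := ub; have := eP _ qp; rewrite qb => -[c _ <-].
  by rewrite tofracM mulrAC mulfK ?tofrac_eq0//; exact: IM.
(* If some [p] is not full, [x] is nonzero because 0 / a lies in [I]; otherwise the condition is
   void and the nonzero [y] serves. *)
have [[p nfp]|allf] := pselect (exists p, ~ full_primes I p).
  exists x; split => //; have [a ua] := ex_uniformizer p pid nfield.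
  apply: contra_notN (xP _ _ ua nfp) => /eqP->.
  by rewrite mul0r.
exists y; split => // p a ua nfp; case: allf.
by exists p.
Qed.

(* Every [z] with [z / x] in the local ring lies in [I] because the ideal of the
   [d] with [d * z] in [I] is contained in no maximal ideal. *)
Lemma submod_classification (D : idomainType) (I : submod D) :
  principal_ideal_domain D -> ~ GRing.field_axiom D ->
  finite_set [set: Max D] ->
  exists2 x, x != 0 &
    forall z, submod_set I z <->
      submod_set (local_ring (full_primes I)) (z / x).
Proof.
move=> pid nfield fin.
have [x [x0 Ix xP]] := ex_minimal_element I pid nfield fin.
have [[I0 ID IM] _] := submodE I.
exists x => // z; split=> [Iz p nfp|zD].
  have [a [b [u [v [b0 zE uv]]]]] := coprime_fracP (z / x) pid.
  exists a, b; split => // pb.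
  have [d ud] := ex_uniformizer p pid nfield; apply: (xP p d ud nfp).
  have Fb0 : tofrac b != 0 by rewrite tofrac_eq0.
  (* By u * a + v * b = 1, x / b equals u * z + v * x. As [d] divides [b], x / d then lies in [I],
     against the choice of [x]. *)
  have Ixb : submod_set I (x / tofrac b).
    rewrite -[x / _]mul1r -tofrac1 -uv tofracD !tofracM mulrDl; apply: ID.
      rewrite -mulrA [_ * (x / _)]mulrCA -zE mulrC [x * _]mulrC divfK// mulrC.
      exact: IM.
    by rewrite -mulrA [_ * (x / _)]mulrC divfK//; exact: IM.
  move: pb; have [d0 ->] := ud => -[c _ cd].
  have c0 : tofrac c != 0.
    by rewrite tofrac_eq0; apply: contraNneq b0 => c0; rewrite -cd c0 mul0r.
  move: Ixb; rewrite -cd tofracM => /(IM c).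
  by rewrite mulrCA invfM mulVKf.
pose S := [set d | submod_set I (tofrac d * z)].
have Sid : is_ideal S.
  split=> [|d e Sd Se|d e Se]; rewrite /S /=.
  - by rewrite tofrac0 mul0r.
  - by rewrite tofracD mulrDl; exact: ID.
  - by rewrite tofracM -mulrA; exact: IM.
apply: contrapT => nIz.
have [|p Sp] := ideal_le_maximal Sid; first by rewrite /S /= tofrac1 mul1r.
(* Either way [S] has an element [s] outside [p]: directly if [p] is full, and otherwise from z / x
   = a / s, which gives s * z = a * x. *)
have [/full_primesP/(_ z)[s ps Is]|nfp] := pselect (full_primes I p).
  exact/ps/Sp.
have [a [s [ps zE]]] := zD p nfp.
apply/ps/Sp; rewrite /S /= -(divfK x0 z) zE mulrA.
rewrite [tofrac s * _]mulrC divfK; first exact: IM.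
by rewrite tofrac_eq0 (maximal_neq0 ps).
Qed.

(** * Closure operations and Moore families *)

(** As t x is closed for [t], hence for [s], one gets s x <= s (t x) = t x. So closed elements
    determine a closure operation, with the order reversed. *)
Lemma closure_op_le_closed d (S : porderType d) (s t : closure_op S) :
  (s <= t)%O <-> forall x, is_closed t x -> is_closed s x.
Proof.
split=> [/closure_op_leP st x tx|h].
  have [ext _ _] := closure_opE s; apply/le_anti.
  by rewrite ext andbT -[leRHS]tx st.
apply/closure_op_leP => x; have [ext _ idem] := closure_opE t.
have [_ mono _] := closure_opE s.
by rewrite -[leRHS]h; [exact/mono/ext|exact: idem].
Qed.

Lemma closed_elementsP d (S : porderType d) (c : closure_op S) x :
  closed_elements c x <-> is_closed c x.
Proof.
split=> [[y _ <-]|cx]; last by exists x.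
by have [_ _ idem] := closure_opE c; exact: idem.
Qed.

Lemma closed_elements_moore T (c : closure_op (set T)) :
  is_moore (closed_elements c).
Proof.
move=> F Fc; apply/closed_elementsP; apply/seteqP; split.
  move=> x cx A FA; have /closed_elementsP <- := Fc _ FA.
  have [_ mono _] := closure_opE c.
  have : (c (\bigcap_(A in F) A) <= c A)%O.
    by apply: mono; apply/subsetPset; exact: bigcap_inf.
  by move=> /subsetPset; exact.
by have [/(_ (\bigcap_(A in F) A))/subsetPset] := closure_opE c.
Qed.

Definition closed_moore T (c : closure_op (set T)) : moore T :=
  Moore (asboolT (@closed_elements_moore _ c)).

Lemma mooreE T (Y : moore T) : is_moore Y.
Proof. exact/asboolP/(mooreP Y). Qed.

Lemma moore_hull_closure T (Y : moore T) :
  is_closure (fun A : set T =>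
    \bigcap_(B in [set B | moore_set Y B /\ A `<=` B]) B).
Proof.
split=> [A|A B /subsetPset AB|A].
- by apply/subsetPset => x Ax B [_]; exact.
- apply/subsetPset => x hx C [YC BC]; apply: hx; split => //.
  exact: subset_trans BC.
- apply/seteqP; split => [x hx|x hx B [_]]; last by exact.
  by apply: hx; split => //; apply: (@mooreE _ Y) => B [].
Qed.

Definition moore_hull T (Y : moore T) : closure_op (set T) :=
  ClosureOp (asboolT (moore_hull_closure Y)).

Lemma moore_hull_closed T (Y : moore T) A :
  is_closed (moore_hull Y) A <-> moore_set Y A.
Proof.
split=> [<-|YA]; first by apply: (@mooreE _ Y) => B [].
apply/seteqP; split => [x|x Ax B [_]]; last by exact.
by apply; split.
Qed.

Lemma moore_ext T (Y Z : moore T) :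
  (forall A, moore_set Y A <-> moore_set Z A) -> Y = Z.
Proof. by move=> YZ; apply: val_inj; apply/seteqP; split=> A /YZ. Qed.

Lemma closed_mooreK T : cancel (@closed_moore T) (@moore_hull T).
Proof.
move=> c; apply/le_anti/andP; split; apply/closure_op_le_closed => A.
  by move=> cA; apply/moore_hull_closed/closed_elementsP.
by move=> /moore_hull_closed/closed_elementsP.
Qed.

Lemma moore_hullK T : cancel (@moore_hull T) (@closed_moore T).
Proof.
move=> Y; apply: moore_ext => A.
by split=> [/closed_elementsP/moore_hull_closed|
           /moore_hull_closed/closed_elementsP].
Qed.

Lemma closed_moore_le T (c1 c2 : closure_op (set T)) :
  (closed_moore c1 <= closed_moore c2)%O = (c2 <= c1)%O.
Proof.
apply/idP/idP => [/moore_leP h|/closure_op_le_closed h].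
  by apply/closure_op_le_closed => A /closed_elementsP/h/closed_elementsP.
by apply/moore_leP => A /closed_elementsP/h/closed_elementsP.
Qed.

(** * Closed submodules of a semistar operation *)

(** Here J = y I. With Y = D y^-1, the product of Y and s J lies in s (Y J), which lies in s I = I;
    hence s J lies in y I = J. *)
Lemma semistar_scale_closed (D : idomainType) (s : semistar D)
    (I J : submod D) y :
  y != 0 -> (forall x, submod_set I x <-> submod_set J (y * x)) ->
  is_closed s I -> is_closed s J.
Proof.
move=> y0 IJ sI; have [ext mono _] := closure_opE s.
(* The semistar axiom multiplies submodules only, so y^-1 is replaced by the submodule that it
   generates. *)
have Ynz : is_nz_submodule [set w | exists d : D, w = tofrac d / y].
  split; last first.
    by exists y^-1; [exists 1; rewrite tofrac1 mul1r|rewrite invr_neq0].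
  split; first by exists 0; rewrite tofrac0 mul0r.
    by move=> _ _ [a ->] [b ->]; exists (a + b); rewrite tofracD mulrDl.
  by move=> c _ [a ->]; exists (c * a); rewrite tofracM mulrA.
pose Y := mk_submod Ynz.
have YJ : (submod_mul Y J <= I)%O.
  have [Isub _] := submodE I; have [_ _ IM] := Isub.
  apply/submod_leP; apply: setprod_sub => // _ z [a ->] Jz.
  by rewrite -mulrA; apply: IM; apply/IJ; rewrite mulVKf.
apply/le_anti; rewrite ext andbT; apply/submod_leP => z sJz.
have /IJ : submod_set I (y^-1 * z); last by rewrite mulVKf.
have /submod_leP := @semistarE _ s Y J; have /submod_leP YJI := mono _ _ YJ.
rewrite -sI => h; apply/YJI/h; apply: setprod_in => //.
have /submod_leP := ext Y; apply.
by exists 1; rewrite tofrac1 mul1r.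
Qed.

(** With A the common set of full primes, I = x D_A and J = y D_A, so J = (y / x) I. *)
Lemma semistar_closed_full_primes (D : idomainType) (s : semistar D)
    (I J : submod D) :
  principal_ideal_domain D -> ~ GRing.field_axiom D ->
  finite_set [set: Max D] ->
  full_primes I = full_primes J -> is_closed s I -> is_closed s J.
Proof.
move=> pid nfield fin IJ.
have [x x0 xP] := submod_classification I pid nfield fin.
have [y y0 yP] := submod_classification J pid nfield fin.
apply: (@semistar_scale_closed _ _ _ _ (y / x)).
  by rewrite mulf_neq0// invr_neq0.
move=> z; apply: (iff_trans (xP z)); apply: (iff_trans _ (iff_sym (yP _))).
by rewrite IJ -mulrA mulrAC mulrCA divff// mulr1.
Qed.

(** * The correspondence with Moore families *)

Definition full_prime_sets (D : idomainType) (s : semistar D) :=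
  [set full_primes (s I) | I in [set: submod D]].

Definition moore_semistar (D : idomainType) (Y : set (set (Max D))) :
    semistar D :=
  semistar_inf [set v_op I | I in [set I : submod D | Y (full_primes I)]].

Lemma full_prime_setsP (D : idomainType) (s : semistar D) (I : submod D) :
  principal_ideal_domain D -> ~ GRing.field_axiom D ->
  finite_set [set: Max D] ->
  full_prime_sets s (full_primes I) <-> is_closed s I.
Proof.
move=> pid nfield fin.
split=> [[J _ sJ]|sI]; last by exists I => //; rewrite sI.
apply: semistar_closed_full_primes sJ _ => //.
by have [_ _ idem] := closure_opE s; exact: idem.
Qed.

(** Let B be the intersection of [F]. The closure of D_B lies in D_A for every A in [F], and a prime
    outside B is outside some such A, so D_B is closed. *)
Lemma full_prime_sets_moore (D : idomainType) (s : semistar D) :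
  principal_ideal_domain D -> ~ GRing.field_axiom D ->
  finite_set [set: Max D] -> is_moore (full_prime_sets s).
Proof.
move=> pid nfield fin F Fs.
rewrite -(full_primes_local_ring (\bigcap_(A in F) A) pid nfield).
apply/full_prime_setsP => //; have [ext mono _] := closure_opE s.
apply/le_anti; rewrite ext andbT; apply/submod_leP => x sx p.
have sub A : F A -> submod_set (local_ring A) x.
  move=> FA; have : is_closed s (local_ring A).
    apply/full_prime_setsP => //; rewrite full_primes_local_ring//.
    exact: Fs.
  move=> <-; have /submod_leP :
      (s (local_ring (\bigcap_(A in F) A)) <= s (local_ring A))%O.
    by apply/mono/submod_leP => y hy q Aq; apply: hy => h; exact/Aq/(h A FA).
  exact.
move=> Fp; apply: contrapT => xp; apply: Fp => A FA.
by apply: contrapT => Ap; apply/xp/(sub A FA).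
Qed.

(** Test against 1, which lies in (J : J). *)
Lemma v_op_self (D : idomainType) (J : submod D) : is_closed (v_op J) J.
Proof.
apply: submod_inj; apply/seteqP; split=> x.
  by move=> /(_ 1); rewrite mulr1; apply => y; rewrite mul1r.
by move=> Jx y; rewrite mulrC; exact.
Qed.

(** If full I is in [Y], then v(I) takes part in the infimum and fixes [I]. Conversely, if [I] is
    closed, full I is the intersection of the sets full J in [Y] such that y I lies in J for some
    nonzero y. *)
Lemma moore_semistar_closed (D : idomainType) (Y : moore (Max D))
    (I : submod D) :
  principal_ideal_domain D -> ~ GRing.field_axiom D ->
  is_closed (moore_semistar Y) I <-> moore_set Y (full_primes I).
Proof.
move=> pid nfield; split=> [cI|YI]; last first.
  have [ext _ _] := closure_opE (moore_semistar Y).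
  apply/le_anti; rewrite ext andbT; apply/submod_leP => x hx.
  by rewrite -[I]v_op_self; apply: hx; exists I.
pose F := [set A | exists J y, [/\ moore_set Y A, A = full_primes J, y != 0 &
  forall x, submod_set I x -> submod_set J (y * x)]].
suff -> : full_primes I = \bigcap_(A in F) A.
  by apply: (@mooreE _ Y) => A [J [y []]].
apply/seteqP; split=> [p Ip A [J [y [_ -> y0 IJ]]]|p hp].
  exact: (full_primes_scale_le y0 IJ).
have [a ua] := ex_uniformizer p pid nfield.
apply/(full_primes_div _ pid ua) => x Ix.
(* To get x / a into v(J)(I), multiply by any [y] in (J : I): x * y is in [J], and [J] admits
   division by [a] unless [y] is zero, a trivial case. *)
rewrite -cI => _ [J YJ <-] y IJy.
have [->|y0] := eqVneq y 0.
  by rewrite mulr0; have [[]] := submodE J.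
have /(full_primes_div _ pid ua)/(_ (x * y)) : full_primes J p.
  apply: hp; exists J, y; split => // z Iz; exact: IJy.
rewrite mulrAC; apply; rewrite mulrC; exact: IJy.
Qed.

Theorem theorem1p2 (D : idomainType)
    (D_pid : principal_ideal_domain D)
    (D_not_field : ~ GRing.field_axiom D)
    (D_Max_finite : finite_set [set: Max D]) :
  (let Theta (c : closure_op (set (Max D))) : semistar D :=
     semistar_inf [set v_op I | I in
       [set I : submod D | closed_elements c (full_primes I)]] in
   order_iso Theta
   /\ (forall c : closure_op (set (Max D)),
         is_greatest
           [set s : semistar D | forall I : submod D,
              is_closed c (full_primes I) -> is_closed s I]
           (Theta c)))
  /\
  (exists Phi : semistar D -> moore (Max D),
     (forall s : semistar D,
        Phi s = [set full_primes (s I) | I in [set: submod D]]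
          :> set (set (Max D)))
     /\ order_anti_iso Phi
     /\ (let Psi (Y : moore (Max D)) : semistar D :=
           semistar_inf [set v_op I | I in
             [set I : submod D | moore_set Y (full_primes I)]] in
         cancel Phi Psi /\ cancel Psi Phi)).
Proof.
pose Phi (s : semistar D) : moore (Max D) :=
  Moore (asboolT (@full_prime_sets_moore _ s D_pid D_not_field D_Max_finite)).
pose Psi (Y : moore (Max D)) := moore_semistar Y.
(* The rest is formal: [PhiP] and [PsiP] translate between closed submodules and members of
   families. *)
have PhiP s I : moore_set (Phi s) (full_primes I) <-> is_closed s I.
  exact: full_prime_setsP.
have PsiP Y I : is_closed (Psi Y) I <-> moore_set Y (full_primes I).
  exact: moore_semistar_closed.
(* Every [A] is full I for some I, so families can be compared on the sets full I. *)
have fullK (A : set (Max D)) : full_primes (local_ring A) = A.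
exact: (full_primes_local_ring A D_pid D_not_field).
have leP (s t : semistar D) :
    (s <= t)%O <-> forall I, is_closed t I -> is_closed s I.
  exact: (@closure_op_le_closed _ _ s t).
have PhiK : cancel Phi Psi.
  move=> s; apply/le_anti/andP; split; apply/leP => I.
    by move=> /PhiP/PsiP.
  by move=> /PsiP/PhiP.
have PsiK : cancel Psi Phi.
  move=> Y; apply: moore_ext => A; rewrite -(fullK A).
  by split=> [/PhiP/PsiP|/PsiP/PhiP].
have PhiM : {mono Phi : x y /~ (x <= y)%O}.
  move=> s t; apply/idP/idP => [/moore_leP h|/leP h].
    by apply/leP => I /PhiP/h/PhiP.
  by apply/moore_leP => A; rewrite -(fullK A) => /PhiP/h/PhiP.
split; last by exists Phi; split=> //; split=> //; split=> //; exists Psi.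
(* By unfolding, [Theta] is [Psi] after [closed_moore]; both reverse the order, so [Theta] preserves
   it. *)
move=> Theta; have ThetaE c : Theta c = Psi (closed_moore c). by [].
split; last first.
  move=> c; split=> [I cI|s sP].
    by rewrite ThetaE; apply/PsiP/closed_elementsP.
  by apply/leP => I; rewrite ThetaE => /PsiP/closed_elementsP/sP.
split; last first.
  by move=> c1 c2; rewrite !ThetaE -PhiM !PsiK closed_moore_le.
exists (fun s => moore_hull (Phi s)) => [c|s].
  by rewrite ThetaE PsiK closed_mooreK.
by rewrite ThetaE moore_hullK PhiK.
Qed.
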